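(* Let $X$ be a Tychonoff space which is pseudocompact or satisfies the countable chain condition. Then $X$ is countably $\varkappa$-metrizable if and only if $X$ is $\varkappa$-metrizable.
   Context: For a space $X$, $\mathrm{RC}(X)$ is the set of regular closed subsets of $X$ (sets $A$ with $\mathrm{cl}\,\mathrm{int}\,A=A$). A $\varkappa$-metric on $X$ is a function $\varrho:X\times \mathrm{RC}(X)\to[0,\infty)$ such that: (K1) $\varrho(x,C)=0$ if and only if $x\in C$, for all $x\in X$, $C\in\mathrm{RC}(X)$; (K2) if $C\subseteq D$ then $\varrho(x,C)\ge\varrho(x,D)$, for all $x\in X$, $C,D\in\mathrm{RC}(X)$; (K3) $\varrho(\cdot,C)$ is continuous for every $C\in\mathrm{RC}(X)$; (K4) $\varrho(x,\mathrm{cl}(\bigcup_{\alpha<\lambda}C_\alpha))=\inf_{\alpha<\lambda}\varrho(x,C_\alpha)$ for every non-decreasing totally ordered sequence $\{C_\alpha:\alpha<\lambda\}\subseteq\mathrm{RC}(X)$ and every $x\in X$. A countable $\varkappa$-metric is a function $\varrho:X\times\mathrm{RC}(X)\to[0,\infty)$ satisfying (K1)–(K3) and (K4$_\omega$) $\varrho(x,\mathrm{cl}(\bigcup_{n<\omega}C_n))=\inf_{n<\omega}\varrho(x,C_n)$ for every chain $\{C_n:n<\omega\}\subseteq\mathrm{RC}(X)$ and every $x\in X$. $X$ is $\varkappa$-metrizable (resp. countably $\varkappa$-metrizable) if it admits a $\varkappa$-metric (resp. a countable $\varkappa$-metric). *)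

(* Defs.v *)
From HB Require Import structures.
From mathcomp Require Import all_boot all_order all_algebra.
From mathcomp Require Import all_classical all_reals all_analysis wochoice.

Set Implicit Arguments.
Unset Strict Implicit.
Unset Printing Implicit Defensive.

Import Order.TTheory GRing.Theory Num.Theory.
Import numFieldNormedType.Exports.

Local Open Scope classical_set_scope.
Local Open Scope ring_scope.

(* completely_regular_space does not include any separation axiom; it amounts
   to separation of points and closed sets by continuous real functions, by
   uniform_separatorP. *)
Definition tychonoff_space (X : topologicalType) : Prop :=
  @accessible_space X /\ completely_regular_space X.

Definition pseudocompact_space (R : realType) (X : topologicalType) : Prop :=
  forall f : X -> R, continuous f -> bounded_fun f.

Definition countable_chain_condition (X : topologicalType) : Prop :=
  forall U : set (set X),
    (forall A, U A -> open A /\ A !=set0) -> trivIset U id -> countable U.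

(* A function X * RC(X) -> [0, oo[ is represented by a total function
   X -> set X -> R of which only the values at regular closed sets are
   ever constrained or used. *)
Record kappa_premetric (R : realType) (X : topologicalType)
    (rho : X -> set X -> R) : Prop := {
  kappa_ge0 : forall x C, regclosed C -> 0 <= rho x C ;
  kappa_eq0 : forall x C, regclosed C -> (rho x C = 0 <-> C x) ;
  kappa_anti : forall x C D, regclosed C -> regclosed D ->
    C `<=` D -> rho x D <= rho x C ;
  kappa_continuous : forall C, regclosed C -> continuous (rho^~ C)
}.

(* Sequences (C_alpha)_(alpha < lambda), for a nonzero ordinal lambda, are
   families indexed by a nonempty type I well-ordered by le.  The index must be
   nonempty: there is no infimum of the empty set in [0, oo[, and inf set0 = 0
   would contradict kappa_eq0. *)
Definition kappa_metric (R : realType) (X : topologicalType)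
    (rho : X -> set X -> R) : Prop :=
  kappa_premetric rho /\
  forall (I : Type) (le : rel I) (C : I -> set X),
    well_order le -> inhabited I ->
    (forall i, regclosed (C i)) ->
    (forall i j, le i j -> C i `<=` C j) ->
    forall x, rho x (closure (\bigcup_i C i)) = inf (range (fun i => rho x (C i))).

(* As a chain, the family is totally ordered by inclusion, but need not be
   monotone in n. *)
Definition countable_kappa_metric (R : realType) (X : topologicalType)
    (rho : X -> set X -> R) : Prop :=
  kappa_premetric rho /\
  forall C : nat -> set X,
    (forall n, regclosed (C n)) ->
    total_on (range C) subset ->
    forall x, rho x (closure (\bigcup_n C n)) = inf (range (fun n => rho x (C n))).

Definition kappa_metrizable (R : realType) (X : topologicalType) : Prop :=
  exists rho : X -> set X -> R, kappa_metric rho.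

Definition countably_kappa_metrizable (R : realType) (X : topologicalType) :
    Prop :=
  exists rho : X -> set X -> R, countable_kappa_metric rho.

(* Main.v *)
Require Import Defs.
From mathcomp Require Import all_boot all_order all_algebra.
From mathcomp Require Import all_classical all_reals all_analysis.
From mathcomp Require Import wochoice.

(** A countable kappa-metric is a kappa-metric as soon as the space is ccc:
    the nonempty sets among the differences
    int C_i \ cl (\bigcup_(j < i) int C_j) are pairwise disjoint, hence there
    are countably many of them, and the corresponding countable subfamily has
    the same closed union.

    A pseudocompact countably kappa-metrizable space is ccc.  Otherwise there
    are disjoint open sets U_n, points x_n \in U_n and e > 0 with
    rho x_n F_n > e, where F_n := cl (X \ cl U_n).  The open sets
    V_n := {rho _ F_n > e} form a locally finite family: with
    C_n := cl (U_0 \cup ... \cup U_n), a point p outside cl (\bigcup_n C_n) has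
    a neighborhood missing every V_n, and any other p satisfies rho p C_n < e
    for some n by the countable union axiom, so that {rho _ C_n < e} is a
    neighborhood of p missing V_m for m > n, since C_n is included in F_m.
    A locally finite sum of functions supported by the V_n is then an
    unbounded continuous function. *)

Set Implicit Arguments.
Unset Strict Implicit.
Unset Printing Implicit Defensive.

Import Order.TTheory GRing.Theory Num.Theory.
Import numFieldNormedType.Exports.

Local Open Scope classical_set_scope.
Local Open Scope ring_scope.

(** * Well-ordered families under the countable chain condition *)

Section WellOrder.
Variables (I : Type) (le : rel I).
Hypothesis le_wo : well_order le.

Lemma well_order_min (P : set I) :
  P !=set0 -> exists2 i, P i & forall j, P j -> le i j.
Proof.
case=> i0 Pi0; have [|i [[Pi lei] _]] := le_wo (A := [pred i | `[<P i>]]).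
  by exists i0; rewrite unfold_in; apply/asboolP.
exists i; first by move: Pi; rewrite unfold_in => /asboolP.
by move=> j Pj; apply: lei; rewrite unfold_in; apply/asboolP.
Qed.

Lemma well_order_refl i : le i i.
Proof. by have [|j -> ->] := @well_order_min [set i]; first by exists i. Qed.

Lemma well_order_total i j : le i j \/ le j i.
Proof.
have [|k [] -> lek] := @well_order_min [set i; j]; first by exists i; left.
- by left; apply: lek; right.
- by right; apply: lek; left.
Qed.

(** Both [i] and [j] are minima of the pair they form, and a well-order has unique minima. *)
Lemma well_order_anti i j : le i j -> le j i -> i = j.
Proof.
move=> leij leji; have [|k [_ uk]] := le_wo (A := [pred k | `[<k = i \/ k = j>]]).
  by exists i; rewrite unfold_in; apply/asboolP; left.
rewrite -(uk i) ?(uk j) //; split.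
- by rewrite unfold_in; apply/asboolP; right.
- by move=> l; rewrite unfold_in => /asboolP[] -> //; apply: well_order_refl.
- by rewrite unfold_in; apply/asboolP; left.
- by move=> l; rewrite unfold_in => /asboolP[] -> //; apply: well_order_refl.
Qed.

Lemma well_order_ind (P : I -> Prop) :
  (forall i, (forall j, ~~ le i j -> P j) -> P i) -> forall i, P i.
Proof.
move=> Pind i; apply: contrapT => nPi.
have [|k nPk lek] := @well_order_min [set k | ~ P k]; first by exists i.
by apply: nPk; apply: Pind => j; apply: contraNP => /lek.
Qed.

Lemma ccc_countable_dense_subfamily (X : topologicalType) (G : I -> set X) :
  countable_chain_condition X -> inhabited I -> (forall i, open (G i)) ->
  exists g : nat -> I, \bigcup_i G i `<=` closure (\bigcup_n G (g n)).
Proof.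
move=> cccX [i0] Gopen.
pose jump i := G i `\` closure (\bigcup_(j in [set j | ~~ le i j]) G j).
have jump_disj i j x : jump i x -> jump j x -> i = j.
  wlog leij : i j / le i j => [wlg|] ix jx.
    by have [/wlg|/wlg wji] := well_order_total i j; [exact | apply/esym/wji].
  apply: well_order_anti => //; apply: contrapT => /negP ji.
  apply: jx.2; apply: subset_closure; exists i => //; exact: ix.1.
have : countable [set A | exists2 i, A = jump i & A !=set0].
  apply: cccX => [A [i -> jne]|]; last first.
    move=> _ _ [i -> _] [j -> _] [x [jix jjx]].
    by rewrite (jump_disj _ _ _ jix jjx).
  by split=> //; rewrite /jump setDE; apply: openI => //; rewrite openC; exact: closed_closure.
move=> /countable_injP[f finj].
(* [f] codes the nonempty jumps by naturals; [g n] is the index of the jump with code [n], or the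
   default [i0] if there is none. *)
have /choice[g gP] n : exists k, forall i,
    jump i !=set0 -> f (jump i) = n -> k = i.
  have [[k [kne fk]]|nex] := pselect (exists k, jump k !=set0 /\ f (jump k) = n).
    exists k => i ine fi; have [x kx] := kne; apply: (jump_disj _ _ x) => //.
    by rewrite -(finj _ _ _ _ (etrans fk (esym fi)))// inE; [exists k|exists i].
  by exists i0 => i ine fi; case: nex; exists i.
(* Induction along the well-order: a point of [G i] lies either in the closure of the earlier
   members, covered by the induction hypothesis, or in [jump i], whose index was selected by [g]. *)
exists g => x [i _]; move: i x; apply: well_order_ind => i IH x Gx.
have [clx|nclx] := pselect (closure (\bigcup_(j in [set j | ~~ le i j]) G j) x).
  move: clx.
  suff : closure (\bigcup_(j in [set j | ~~ le i j]) G j) `<=`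
         closure (closure (\bigcup_n G (g n))).
    by rewrite -(proj1 (closure_id _) (@closed_closure _ _)); apply.
  by apply: closureS => y [j /= ij Gy]; exact: IH Gy.
apply: subset_closure; exists (f (jump i)) => //.
by rewrite (gP _ i) //; exists x.
Qed.

End WellOrder.

(** * Comparison of the two union axioms *)

(** Each [C i] is the closure of its interior, so the set is also the closure of the open union of
    the interiors. *)
Lemma regclosed_closure_bigcup (X : topologicalType) (I : Type)
    (C : I -> set X) :
  (forall i, regclosed (C i)) -> regclosed (closure (\bigcup_i C i)).
Proof.
move=> Creg; suff -> : closure (\bigcup_i C i) = closure (\bigcup_i (C i)°).
  apply: closure_open_regclosed; apply: bigcup_open => i _.
  exact: open_interior.
apply/seteqP; split; last first.
  by apply: closureS; apply: subset_bigcup => i _; exact: interior_subset.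
rewrite [X in _ `<=` X](proj1 (closure_id _) (@closed_closure _ _)).
apply: closureS => x [i _]; rewrite -(Creg i).
by apply: closureS; exact: (@bigcup_sup _ _ i).
Qed.

Lemma ccc_kappa_metric (R : realType) (X : topologicalType)
    (rho : X -> set X -> R) :
  countable_chain_condition X -> countable_kappa_metric rho -> kappa_metric rho.
Proof.
move=> cccX [prho rhoU]; split=> // I le C le_wo I0 Creg Cmono x.
have [g gP] := ccc_countable_dense_subfamily le_wo cccX I0
  (fun i => @open_interior _ (C i)).
have Ureg := regclosed_closure_bigcup Creg.
have CgE : closure (\bigcup_i C i) = closure (\bigcup_n C (g n)).
  apply/seteqP; split; last by apply: closureS => y [n _ Cy]; exists (g n).
  rewrite [X in _ `<=` X](proj1 (closure_id _) (@closed_closure _ _)).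
  apply: closureS => y [i _]; rewrite -(Creg i).
  suff : (C i)° `<=` closure (\bigcup_n C (g n)).
    move=> /closureS; rewrite -(proj1 (closure_id _) (@closed_closure _ _)).
    exact.
  apply: subset_trans (_ : _ `<=` closure (\bigcup_n (C (g n))°)) _.
    by apply: subset_trans gP; exact: (@bigcup_sup _ _ i).
  by apply: closureS; apply: subset_bigcup => n _; exact: interior_subset.
apply/le_anti/andP; split.
  apply: lb_le_inf; first by case: I0 => i; exists (rho x (C i)); exists i.
  move=> _ [i _ <-]; apply: (kappa_anti prho) => //.
  by apply: subset_trans (@subset_closure _ _); exact: (@bigcup_sup _ _ i).
(* The countable axiom applies to the subfamily, whose infimum is at least that of the whole
   family. *)
rewrite CgE (rhoU (C \o g)).
- apply: lb_le_inf; first by exists (rho x (C (g 0%N))); exists 0%N.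
  move=> _ [n _ <-]; apply: ge_inf; last by exists (g n).
  by exists 0 => _ [i _ <-]; exact: (kappa_ge0 prho).
- by move=> n; exact: Creg.
- move=> _ _ [n _ <-] [m _ <-] /=.
  by have [/Cmono|/Cmono] := well_order_total le_wo (g n) (g m); [left|right].
Qed.

Lemma leq_well_order : well_order leq.
Proof.
apply: antisymmetric_well_order => [m n|A Ane]; first by rewrite -eqn_leq => /eqP.
by case: (ex_minnP Ane) => m Am mmin; exists m; split=> // n /mmin.
Qed.

(** Each finite partial union of a chain is one of its members, so passing to partial unions keeps
    the sets regular closed and changes neither the union nor the infimum. *)
Lemma kappa_metric_countable (R : realType) (X : topologicalType)
    (rho : X -> set X -> R) :
  kappa_metric rho -> countable_kappa_metric rho.
Proof.
move=> [prho rhoU]; split=> // C Creg Ctot x.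
pose D n := \bigcup_(k in [set k | (k <= n)%N]) C k.
(* The partial unions D n turn the chain C into a monotone sequence. *)
have DE n : exists2 k, (k <= n)%N & D n = C k.
  elim: n => [|n [k kn Dn]].
    exists 0%N => //; apply/seteqP; split=> [y [k /=]|y Cy]; last by exists 0%N.
    by rewrite leqn0 => /eqP ->.
  have DS : D n.+1 = C k `|` C n.+1.
    rewrite -Dn; apply/seteqP; split=> [y [j /=]|y [[j /= jn Cy]|Cy]].
    - rewrite leq_eqVlt ltnS => /orP[/eqP ->|jn] Cy; first by right.
      by left; exists j.
    - by exists j => //=; exact: leqW.
    - by exists n.+1 => /=.
  have [//|//|Ckn|Cnk] := Ctot (C k) (C n.+1).
  - by exists n.+1; rewrite // DS; exact/setUidPr.
  - by exists k; [exact: leqW | rewrite DS; exact/setUidPl].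
have -> : \bigcup_n C n = \bigcup_n D n.
  apply/seteqP; split=> [y [n _ Cy]|y [n _ [k _ Cy]]]; last by exists k.
  by exists n => //; exists n => /=.
rewrite (rhoU _ leq D leq_well_order).
- have lb0 (E : nat -> set X) : (forall n, regclosed (E n)) ->
      has_lbound (range (fun n => rho x (E n))).
    by move=> Ereg; exists 0 => _ [n _ <-]; exact: (kappa_ge0 prho).
  have Dreg n : regclosed (D n) by have [k _ ->] := DE n.
  apply/le_anti/andP; split; apply: lb_le_inf.
  + by exists (rho x (C 0%N)); exists 0%N.
  + move=> _ [n _ <-]; apply: (@le_trans _ _ (rho x (D n))).
      by apply: ge_inf; [exact: lb0 | exists n].
    by apply: (kappa_anti prho) => // y Cy; exists n => /=.
  + by exists (rho x (D 0%N)); exists 0%N.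
  + move=> _ [n _ <-]; have [k _ ->] := DE n.
    by apply: ge_inf; [exact: lb0 | exists k].
- exact: inhabits 0%N.
- by move=> n; have [k _ ->] := DE n.
- by move=> i j ij y [k /= ki Cy]; exists k => //=; exact: leq_trans ij.
Qed.

(** * From pseudocompactness to the countable chain condition *)

(** The locally finite sum of the [h n] is continuous, hence bounded, and it dominates each
    nonnegative term. *)
Lemma pseudocompact_locally_finite_bounded (R : realType) (X : topologicalType)
    (h : nat -> X -> R) :
  pseudocompact_space R X -> (forall n, continuous (h n)) ->
  (forall n x, 0 <= h n x) ->
  (forall p : X, exists N, \forall y \near p, forall m, (N <= m)%N -> h m y = 0) ->
  exists M, forall n x, h n x <= M.
Proof.
move=> pcX hcont h0 /choice[N NP].
pose S n x := \sum_(k < n) h k x.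
have SE n m x : (forall k, (n <= k)%N -> h k x = 0) ->
    (forall k, (m <= k)%N -> h k x = 0) -> S n x = S m x.
  wlog nm : n m / (n <= m)%N => [wlg|] hn hm.
    by have [/wlg|/ltnW/wlg wmn] := leqP n m; [exact | apply/esym/wmn].
  rewrite /S -!(big_mkord xpredT (fun k => h k x)) (big_cat_nat (leq0n n) nm)//=.
  rewrite [X in _ + X]big_nat [X in _ + X]big1 ?addr0// => k /andP[nk _]; exact: hn.
pose f x := S (N x) x.
have fE x m : (forall k, (m <= k)%N -> h k x = 0) -> f x = S m x.
  by move=> hm; apply: SE => //; exact: nbhs_singleton (NP x).
have fcont : continuous f.
  (* Near [p] the cutoff [N p] is valid, so [f] agrees there with one fixed finite sum. *)
  move=> p; have Scont : {for p, continuous (S (N p))}.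
    apply: cvg_big => [|i _]; [exact: add_continuous | exact: hcont].
  apply: cvg_trans Scont; apply: near_eq_cvg.
  by apply: filterS (NP p) => y hy; rewrite (fE y (N p)).
have /bounded_fun_has_ubound[M fM] := pcX f fcont.
exists M => n x; apply: le_trans (fM (f x) _); last by exists x.
(* Raising the cutoff to at least [n.+1] ensures that the term [h n] occurs in the sum. *)
have hN m : (maxn (N x) n.+1 <= m)%N -> h m x = 0.
  rewrite geq_max => /andP[Nm _]; exact: nbhs_singleton (NP x) _ Nm.
rewrite (fE _ _ hN) /S (bigD1 (Ordinal (leq_maxr (N x) n.+1)))//=.
by rewrite lerDl sumr_ge0.
Qed.

Lemma open_disjoint_closure (X : topologicalType) (A B : set X) :
  open A -> A `&` B = set0 -> A `&` closure B = set0.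
Proof.
move=> Aopen AB0; apply/seteqP; split=> // x [Ax /(_ A)[|y [By Ay]]].
  exact: open_nbhs_nbhs.
by have : (A `&` B) y by []; rewrite AB0.
Qed.

Lemma pseudocompact_ccc (R : realType) (X : topologicalType)
    (rho : X -> set X -> R) :
  pseudocompact_space R X -> countable_kappa_metric rho ->
  countable_chain_condition X.
Proof.
move=> pcX [prho rhoU] U UP Utriv; apply: contrapT => Unc.
pose F (A : set X) := closure (~` closure A).
have Freg A : regclosed (F A).
  by apply: closure_open_regclosed; rewrite openC; exact: closed_closure.
have AF0 A : open A -> A `&` F A = set0.
  move=> oA; apply: open_disjoint_closure => //.
  by rewrite -subset0 => x [Ax nAx]; apply: nAx; exact: subset_closure.
(* The sets [T k] exhaust [U], so they cannot all be finite when [U] is uncountable. *)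
pose T k := [set A | U A /\ exists2 x, A x & k.+1%:R^-1 < rho x (F A)].
have [k Tk] : exists k, infinite_set (T k).
  apply: contrapT => /forallNP Tfin; apply: Unc.
  suff -> : U = \bigcup_k T k.
    apply: bigcup_countable => // k _; apply: finite_set_countable.
    exact: contrapT (Tfin k).
  apply/seteqP; split=> [A UA|A [k _ []//]].
  have [oA [x Ax]] := UP A UA.
  have rho_gt0 : 0 < rho x (F A).
    rewrite lt_def (kappa_ge0 prho)// andbT; apply/eqP => /(kappa_eq0 prho).
    by move=> /(_ (Freg A)) FAx; have : (A `&` F A) x by []; rewrite AF0.
  have [k kP] := ltr_add_invr rho_gt0.
  by exists k => //; split=> //; exists x => //; rewrite -[ltLHS]add0r.
pose e : R := k.+1%:R^-1.
have e0 : 0 < e by rewrite invr_gt0.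
have /infiniteP/ppcard_leP[G] := Tk.
have GT n : T k (G n) by exact: funS.
have Gopen n : open (G n) by have [/UP[]] := GT n.
have Gdisj m n : m != n -> G m `&` G n = set0.
  move=> mn; apply/eqP/negP => /negP/set0P GG; move/eqP: mn; apply.
  apply: (@inj _ _ setT G); rewrite ?inE//.
  by apply: (Utriv _ _ _ _ GG); [have [] := GT m | have [] := GT n].
have {GT}/choice[x xP] n : exists x, e < rho x (F (G n)).
  by have [_ [x _ ex]] := GT n; exists x.
pose f n y := rho y (F (G n)).
pose V n := [set y | e < f n y].
pose C n := closure (\bigcup_(j in [set j | (j <= n)%N]) G j).
have Creg n : regclosed (C n) by apply: closure_open_regclosed; exact: bigcup_open.
have Cmono m n : (m <= n)%N -> C m `<=` C n.
  move=> mn; apply: closureS => y [j /= jm Gy]; exists j => //=.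
  exact: leq_trans mn.
(* For [j <= n < m] the open set [G j] misses [G m], hence also its closure. *)
have CF m n : (n < m)%N -> C n `<=` F (G m).
  move=> nm; apply: closureS => y [j /= jn Gy] clGm.
  have : (G j `&` closure (G m)) y by [].
  rewrite open_disjoint_closure// Gdisj//.
  by rewrite neq_ltn (leq_ltn_trans jn nm).
(* A point outside [C n] is outside the closure of [G n], hence in [F (G n)], where [f n]
   vanishes. *)
have VC n : V n `<=` C n.
  move=> y Vy; apply: contrapT => nCy; move: Vy; rewrite /V/= /f.
  suff -> : rho y (F (G n)) = 0 by rewrite ltNge ltW.
  apply/(kappa_eq0 prho) => //; apply: subset_closure => cly; apply: nCy.
  by apply: closureS cly => z Gz; exists n => /=.
have Vlf (p : X) : exists N, \forall y \near p, forall m, (N <= m)%N -> ~ V m y.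
  have [clp|nclp] := pselect (closure (\bigcup_n C n) p); last first.
    exists 0%N.
    have : nbhs p (~` closure (\bigcup_n C n)).
      by apply: open_nbhs_nbhs; split=> //; rewrite openC; exact: closed_closure.
    apply: filterS => y ncl m _ Vy; apply: ncl; apply: subset_closure.
    by exists m => //; exact: VC.
  have inf0 : inf (range (fun n => rho p (C n))) = 0.
    rewrite -rhoU//; first exact/(kappa_eq0 prho)/clp/regclosed_closure_bigcup.
    move=> _ _ [m _ <-] [n _ <-].
    by have [/Cmono|/ltnW/Cmono] := leqP m n; [left|right].
  have [|_ [n _ <-]] := inf_adherent (E := range (fun n => rho p (C n))) e0.
    split; first by exists (rho p (C 0%N)); exists 0%N.
    by exists 0 => _ [n _ <-]; exact: (kappa_ge0 prho).
  rewrite inf0 add0r => rhon; exists n.+1.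
  have /cvgr_lt/(_ _ rhon) := kappa_continuous prho (Creg n) (x := p).
  apply: filterS => y yn m nm; apply/negP; rewrite -leNgt.
  apply/ltW/(le_lt_trans _ yn); apply: (kappa_anti prho) => //; exact: CF.
(* This factor normalizes the bump [h n], which vanishes outside [V n], so that [h n (x n) = n]. *)
pose a n : R := n%:R / (f n (x n) - e).
have a0 n : 0 <= a n by rewrite divr_ge0// subr_ge0 ltW// xP.
pose h n y := a n * Num.max (f n y - e) 0.
have [//|||p|M hM] := @pseudocompact_locally_finite_bounded R X h.
- move=> n y; apply: cvgM; first exact: cvg_cst.
  apply: (@continuous_max _ _ (fun z => f n z - e) (cst 0)); last exact: cvg_cst.
  apply: cvgB; last exact: cvg_cst.
  exact: (kappa_continuous prho (Freg _)).
- by move=> n y; rewrite mulr_ge0// le_max lexx orbT.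
- have [N VN] := Vlf p; exists N; apply: filterS VN => y Vy m /Vy /negP.
  by rewrite /h -leNgt -subr_le0 => /max_r ->; rewrite mulr0.
have := hM (Num.trunc M).+1 (x (Num.trunc M).+1).
have fx_gt n : 0 < f n (x n) - e by rewrite subr_gt0 xP.
rewrite /h (max_l (ltW (fx_gt _))) /a divfK ?gt_eqF ?fx_gt//.
by rewrite leNgt truncnS_gt.
Qed.

(** The same [rho] serves in both directions. *)
Theorem mainTheorem3 (R : realType) (X : topologicalType) :
  tychonoff_space X ->
  pseudocompact_space R X \/ countable_chain_condition X ->
  (countably_kappa_metrizable R X <-> kappa_metrizable R X).
Proof.
move=> _ pc_or_ccc; split=> -[rho]; last first.
  by move=> /kappa_metric_countable; exists rho.
move=> ckm; exists rho; apply: ccc_kappa_metric => //.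
by case: pc_or_ccc => // pcX; exact: pseudocompact_ccc ckm.
Qed.
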